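(* Let $(Q,f)$ be a polymatroid. Suppose that for every pair of flats $(X,Y)$ of $(Q,f)$ there is an extension $(QZ,g)$ of $(Q,f)$ satisfying (AK1) $g(Z|X)=0$ and (AK2') $g(X'|Z)=g(X'|Y)$ for every flat $X'\subseteq X$. Then $(Q,f)$ satisfies the AK property, i.e. for every pair of sets $X,Y\subseteq Q$ there is an extension $(QZ,g)$ of $(Q,f)$ with $g(Z|X)=0$ and $g(X'|Z)=g(X'|Y)$ for every $X'\subseteq X$.
   Context: A polymatroid is a pair $(Q,f)$ with $Q$ finite and $f:\mathcal{P}(Q)\to\mathbb{R}$ satisfying $f(\emptyset)=0$, $f(X)\le f(Y)$ for $X\subseteq Y$, and $f(X\cap Y)+f(X\cup Y)\le f(X)+f(Y)$. Write $XY=X\cup Y$ and $f(X|Y)=f(XY)-f(Y)$. An extension of $(Q,f)$ is a polymatroid $(QZ,g)$ with $Q\cap Z=\emptyset$ and $g(X)=f(X)$ for all $X\subseteq Q$. A flat of $(Q,f)$ is a set $F\subseteq Q$ with $f(Fx)>f(F)$ for every $x\in Q\setminus F$. *)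

(* Defs.v *)
From HB Require Import structures.
From mathcomp Require Import all_boot all_order all_algebra.
From mathcomp Require Import reals.

Set Implicit Arguments.
Unset Strict Implicit.
Unset Printing Implicit Defensive.
Import Order.TTheory GRing.Theory Num.Theory.
Local Open Scope ring_scope.

Definition polymatroid (R : realType) (Q : finType) (f : {set Q} -> R) : Prop :=
  [/\ f set0 = 0,
      forall X Y : {set Q}, X \subset Y -> f X <= f Y &
      forall X Y : {set Q}, f (X :&: Y) + f (X :|: Y) <= f X + f Y].

Definition cond_rank (R : realType) (Q : finType) (f : {set Q} -> R)
    (X Y : {set Q}) : R :=
  f (X :|: Y) - f Y.

Definition flat (R : realType) (Q : finType) (f : {set Q} -> R)
    (F : {set Q}) : Prop :=
  forall x : Q, x \notin F -> f F < f (x |: F).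

(* The ground set QZ of an extension, with Q and Z disjoint, is the sum type
   Q + Z; [old_set Z X] is X, a subset of Q, seen as a subset of QZ, and
   [new_set Q Z] is Z itself seen as a subset of QZ. *)
Definition old_set (Q Z : finType) (X : {set Q}) : {set (Q + Z)%type} :=
  [set inl x | x in X].
Arguments old_set {Q} Z X.

Definition new_set (Q Z : finType) : {set (Q + Z)%type} :=
  [set inr z | z in [set: Z]].
Arguments new_set : clear implicits.

Definition extension (R : realType) (Q Z : finType) (f : {set Q} -> R)
    (g : {set (Q + Z)%type} -> R) : Prop :=
  polymatroid g /\ forall X : {set Q}, g (old_set Z X) = f X.

Definition AK_property (R : realType) (Q : finType) (f : {set Q} -> R) : Prop :=
  forall X Y : {set Q},
  exists (Z : finType) (g : {set (Q + Z)%type} -> R),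
    [/\ extension f g,
        cond_rank g (new_set Q Z) (old_set Z X) = 0 &
        forall X' : {set Q}, X' \subset X ->
          cond_rank g (old_set Z X') (new_set Q Z) = cond_rank g (old_set Z X') (old_set Z Y)].

(* Main.v *)
(* Every set has the same rank as the smallest flat above it, and enlarging a
   set without changing its rank leaves the rank of its union with any other
   set unchanged. Hence the extension given for the closures of X and Y also
   works for X and Y. *)
Require Import Defs.
From HB Require Import structures.
From mathcomp Require Import all_boot all_order all_algebra.
From mathcomp Require Import reals lra.

Set Implicit Arguments.
Unset Strict Implicit.
Unset Printing Implicit Defensive.
Import Order.TTheory GRing.Theory Num.Theory.
Local Open Scope ring_scope.

(** Submodularity for [B] and [A :|: C]: their union is [B :|: C] and their intersection contains
    [A], so [f A + f (B :|: C) <= f B + f (A :|: C)]. *)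
Lemma polymatroid_setU_eq (R : realType) (Q : finType) (f : {set Q} -> R)
    (A B C : {set Q}) :
  polymatroid f -> A \subset B -> f B = f A -> f (B :|: C) = f (A :|: C).
Proof.
move=> [_ mono submod] sAB fBA.
have le_AC : f (A :|: C) <= f (B :|: C) by apply: mono; apply: setSU.
have le_A : f A <= f (B :&: (A :|: C)).
  by apply: mono; rewrite subsetI sAB subsetUl.
have := submod B (A :|: C); rewrite setUA (setUidPl sAB).
lra.
Qed.

(** An inclusion-maximal superset of [A] of the same rank is a flat. *)
Lemma exists_flat_closure (R : realType) (Q : finType) (f : {set Q} -> R)
    (A : {set Q}) :
  polymatroid f -> exists F, [/\ flat f F, A \subset F & f F = f A].
Proof.
move=> [_ mono _].
have [F /maxsetP[/eqP fF maxF] sAF] :=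
  @maxset_exists _ (fun B => f B == f A) A (eqxx _).
exists F; split=> // x xF.
rewrite lt_neqAle mono ?subsetUr // andbT.
apply: contraNneq xF => fFx.
by rewrite -(maxF (x |: F)) ?subsetUr ?setU11 // -fFx fF.
Qed.

Lemma flat_closure_sub (R : realType) (Q : finType) (f : {set Q} -> R)
    (A B F : {set Q}) :
  polymatroid f -> A \subset B -> f B = f A -> flat f F -> A \subset F ->
  B \subset F.
Proof.
move=> pf sAB fBA flatF sAF; apply/subsetP=> x xB.
apply/negPn/negP=> /flatF.
rewrite ltNge => /negP; apply.
(* The right-hand [f F] becomes [f (A :|: F)], then [f (B :|: F)], which bounds [f (x |: F)]. *)
rewrite -{2}(setUidPr sAF) -(polymatroid_setU_eq F pf sAB fBA).
by case: pf => _ mono _; apply: mono; rewrite setSU // sub1set.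
Qed.

(** Equality of ranks passes from [f] to [g]; here [C] may contain new elements, as is needed for
    [C] equal to [Z]. *)
Lemma extension_setU_eq (R : realType) (Q Z : finType) (f : {set Q} -> R)
    (g : {set (Q + Z)%type} -> R) (A B : {set Q}) (C : {set (Q + Z)%type}) :
  extension f g -> A \subset B -> f B = f A ->
  g (old_set Z B :|: C) = g (old_set Z A :|: C).
Proof.
move=> [pg gf] sAB fBA.
by apply: polymatroid_setU_eq; rewrite ?gf //; apply: imsetS.
Qed.

Theorem theorem4p1 (R : realType) (Q : finType) (f : {set Q} -> R)
    (f_polymatroid : polymatroid f)
    (AK_flats : forall X Y : {set Q}, flat f X -> flat f Y ->
      exists (Z : finType) (g : {set (Q + Z)%type} -> R),
        [/\ extension f g,
            cond_rank g (new_set Q Z) (old_set Z X) = 0 &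
            forall X' : {set Q}, flat f X' -> X' \subset X ->
              cond_rank g (old_set Z X') (new_set Q Z) = cond_rank g (old_set Z X') (old_set Z Y)]) :
  AK_property f.
Proof.
move=> X Y.
have [F [flatF sXF fF]] := exists_flat_closure X f_polymatroid.
have [G [flatG sYG fG]] := exists_flat_closure Y f_polymatroid.
have [Z [g [ext AK1 AK2]]] := AK_flats F G flatF flatG.
have gf := ext.2.
exists Z, g; split=> // [|X' sX'X].
  move: AK1; rewrite /cond_rank !gf fF.
  by rewrite setUC (extension_setU_eq _ ext sXF fF) (setUC (old_set Z X)).
have [F' [flatF' sX'F' fF']] := exists_flat_closure X' f_polymatroid.
(* [AK2] speaks only of flats inside [F], so the closure of [X'] must stay there. *)
have sF'F : F' \subset F.
  exact: flat_closure_sub sX'F' fF' flatF (subset_trans sX'X sXF).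
have := AK2 F' flatF' sF'F.
(* [F'] is replaced by [X'] on both sides, next to [Z] and next to [G]; then [G] by [Y]. *)
rewrite /cond_rank !gf fG !(extension_setU_eq _ ext sX'F' fF').
by rewrite (setUC _ (old_set Z G)) (extension_setU_eq _ ext sYG fG) (setUC (old_set Z Y)).
Qed.
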